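(* Let $m$ be a fixed positive integer, $p=\frac12$ and $\varepsilon>0$. If $l=l(n)$ is a sequence of integers with $l\le \left(1-\frac{\varepsilon}{m}\right)\log_2 n$, then asymptotically almost surely $\tilde H_{l-2}(N_m(G(n,p)))=0$.
   Context: $G(n,p)$ is the Erdős–Rényi random graph on $n$ vertices in which each edge appears independently with probability $p$. For a graph $G$ and a nonnegative integer $m$, the multineighbor complex $N_m(G)$ is the simplicial complex in which a set of $q+1$ vertices of $G$ ($q\ge 0$) is a $q$-simplex if and only if these vertices have at least $m$ common neighbors in $G$. $\tilde H_*$ denotes reduced simplicial homology with integer coefficients. A property holds asymptotically almost surely (a.a.s.) if its probability tends to $1$ as $n\to\infty$. *)

(* Defs.v *)
From HB Require Import structures.
From mathcomp Require Import all_boot all_order all_algebra.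
From mathcomp Require Import all_classical all_reals all_analysis.

Set Implicit Arguments.
Unset Strict Implicit.
Unset Printing Implicit Defensive.

Import Order.TTheory GRing.Theory Num.Theory.
Import numFieldNormedType.Exports.

Local Open Scope ring_scope.

Record scomplex (n : nat) := SComplex {
  simplices :> {set {set 'I_n}};
  simplex_neq0 : forall s, s \in simplices -> s != finset.set0;
  simplex_sub : forall s t,
    s \in simplices -> t != finset.set0 -> t \subset s -> t \in simplices }.

(* Integer chains, oriented by the order of 'I_n, are functions on vertex sets;
   the grading is by support.  The empty set is always a face of dimension -1,
   so degree -1 is the augmentation group, and there are no chains in degrees
   below -1. *)
Definition is_chain n (K : scomplex n) (q : int) : pred {ffun {set 'I_n} -> int} :=
  fun c => [forall s, (c s != 0) ==>
    (s \in finset.set0 |: simplices K) && (#|s|%:Z == q + 1)].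

(* On oriented simplices v_0 < ... < v_q this is
   [v_0, ..., v_q] |-> \sum_i (-1)^i [v_0, ..., v_(i-1), v_(i+1), ..., v_q],
   written through the coefficient of each face t; the coefficient of the empty
   face is the augmentation. *)
Definition boundary n (c : {ffun {set 'I_n} -> int}) : {ffun {set 'I_n} -> int} :=
  [ffun t : {set 'I_n} => \sum_(v : 'I_n | v \notin t)
     (-1) ^+ #|[set u in t | (u < v)%N]| * c (v |: t)].

Definition is_cycle n (K : scomplex n) (q : int) : pred {ffun {set 'I_n} -> int} :=
  fun c => is_chain K q c && (boundary c == 0).

Lemma boundaryB n (c d : {ffun {set 'I_n} -> int}) :
  boundary (c - d) = boundary c - boundary d.
Proof.
apply/ffunP => t; rewrite !ffunE -sumrB; apply: eq_bigr => v _.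
by rewrite !ffunE mulrBr.
Qed.

Lemma boundary0 n : @boundary n 0 = 0.
Proof. by rewrite -[X in boundary X](subrr 0) boundaryB subrr. Qed.

Lemma chain_zmod_closed n (K : scomplex n) q : zmod_closed (is_chain K q).
Proof.
split; first by apply/forallP => s; rewrite ffunE eqxx.
move=> c d /forallP hc /forallP hd; apply/forallP => s; apply/implyP.
rewrite !ffunE; have := hc s; have := hd s.
case: (eqVneq (c s) 0) => [->|_ _ /implyP h _]; last exact: h.
case: (eqVneq (d s) 0) => [->|_ /implyP h _ _]; last exact: h.
by rewrite subrr eqxx.
Qed.

Lemma cycle_zmod_closed n (K : scomplex n) q : zmod_closed (is_cycle K q).
Proof.
have [h0 hB] := chain_zmod_closed K q; split.
  rewrite unfold_in /is_cycle; apply/andP; split; first exact: h0.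
  by rewrite boundary0.
move=> c d /andP[hc /eqP bc] /andP[hd /eqP bd].
rewrite unfold_in /is_cycle; apply/andP; split; first exact: hB.
by rewrite boundaryB bc bd subrr.
Qed.

HB.instance Definition _ n (K : scomplex n) q :=
  GRing.isZmodClosed.Build _ (is_cycle K q) (cycle_zmod_closed K q).

Record cycles n (K : scomplex n) (q : int) :=
  Cycle { cycle_chain : {ffun {set 'I_n} -> int};
          cycleP : is_cycle K q cycle_chain }.

HB.instance Definition _ n (K : scomplex n) q :=
  [isSub for @cycle_chain n K q].
HB.instance Definition _ n (K : scomplex n) q :=
  [Choice of cycles K q by <:].
HB.instance Definition _ n (K : scomplex n) q :=
  [SubChoice_isSubZmodule of cycles K q by <:].

Definition is_boundary n (K : scomplex n) (q : int) : pred (cycles K q) :=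
  fun z => `[< exists2 b, is_chain K (q + 1) b & boundary b = val z >].

Lemma is_boundary_zmod_closed n (K : scomplex n) q :
  zmod_closed (@is_boundary n K q).
Proof.
have [h0 hB] := chain_zmod_closed K (q + 1); split.
  apply/asboolP; exists 0; first exact: h0.
  exact: boundary0.
move=> x y /asboolP[b hb bx] /asboolP[c hc cy].
apply/asboolP; exists (b - c); first exact: hB.
by rewrite boundaryB bx cy.
Qed.

HB.instance Definition _ n (K : scomplex n) q :=
  GRing.isZmodClosed.Build _ (@is_boundary n K q)
    (is_boundary_zmod_closed K q).

Definition reduced_homology n (K : scomplex n) (q : int) : zmodType :=
  Quotient.quot (GRing.ZmodClosed.clone _ (@is_boundary n K q) _).

Definition pairs n : {set {set 'I_n}} := [set e : {set 'I_n} | #|e| == 2%N].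

Definition sgraph n := {E : {set {set 'I_n}} | E \subset pairs n}.

Definition adj n (G : sgraph n) (u v : 'I_n) : bool := [set u; v] \in val G.

Definition common_neighbors n (G : sgraph n) (s : {set 'I_n}) : {set 'I_n} :=
  [set w | [forall v in s, adj G v w]].

Definition multineighbor_simplices m n (G : sgraph n) : {set {set 'I_n}} :=
  [set s : {set 'I_n} |
    (s != finset.set0) && (m <= #|common_neighbors G s|)%N].

Lemma multineighbor_neq0 m n (G : sgraph n) s :
  s \in multineighbor_simplices m G -> s != finset.set0.
Proof. by rewrite inE => /andP[]. Qed.

Lemma multineighbor_sub m n (G : sgraph n) (s t : {set 'I_n}) :
  s \in multineighbor_simplices m G -> t != finset.set0 -> t \subset s ->
  t \in multineighbor_simplices m G.
Proof.
rewrite !inE => /andP[_ ms] -> /fintype.subsetP ts /=.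
apply: leq_trans ms _; apply/subset_leq_card/fintype.subsetP => w.
rewrite !inE => /forallP h; apply/forallP => v; apply/implyP => /ts vs.
exact: (implyP (h v)).
Qed.

Definition multineighbor_complex m n (G : sgraph n) : scomplex n :=
  SComplex (@multineighbor_neq0 m n G) (@multineighbor_sub m n G).

Definition er_weight (R : realType) n (p : R) (G : sgraph n) : R :=
  \prod_(e in pairs n) (if e \in val G then p else 1 - p).

Definition er_prob (R : realType) n (p : R) (A : sgraph n -> Prop) : R :=
  \sum_(G : sgraph n | `[< A G >]) er_weight p G.

Definition aas (R : realType) (p : R) (A : forall n, sgraph n -> Prop) : Prop :=
  (er_prob p (A n) @[n --> \oo] --> (1 : R))%classic.

Definition log2 (R : realType) (x : R) : R := ln x / ln 2.

(* Main.v *)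
Require Import Defs.
From mathcomp Require Import all_boot all_order all_algebra.
From mathcomp Require Import all_classical all_reals all_analysis.
From mathcomp Require Import ring lra zify.
Import Order.TTheory GRing.Theory Num.Theory.
Import numFieldNormedType.Exports.
Local Open Scope ring_scope.

(* Write d = eps / m.  If every nonempty vertex set of size l has at least m
   common neighbors, then N_m contains all simplices of dimension l - 1, so every
   (l - 2)-cycle bounds its cone from vertex 0 and the homology vanishes.

   For a set s of size k = l, the events "w is adjacent to all of s" (w outside s)
   are independent of probability 2^-k, so the number X of common neighbors
   satisfies E[2^-X] = (1 - 2^-(k+1))^(n-k), and Markov's inequality gives
   P(X < m) <= 2^m (1 - 2^-(k+1))^(n-k).  Since 2^k <= n^(1-d), summing over at
   most n^k = exp(O((ln n)^2)) sets leaves 2^m exp(O((ln n)^2) - n^d / 4), which is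
   at most 2^m / n for n large. *)

(** * Coning off cycles and vanishing homology *)

Lemma skeleton_cycle_bounds (n : nat) (K : scomplex n.+1) (q : int)
    (c : {ffun {set 'I_n.+1} -> int}) :
  (forall s : {set 'I_n.+1},
    s != finset.set0 -> #|s|%:Z = q + 2 -> s \in simplices K) ->
  is_cycle K q c -> exists2 b, is_chain K (q + 1) b & boundary b = c.
Proof.
move=> hK /andP[/forallP hc /eqP dc].
(* The vertex ord0 is the least one, so coning introduces no sign. *)
pose b : {ffun {set 'I_n.+1} -> int} :=
  [ffun s : {set 'I_n.+1} => if ord0 \in s then c (s :\ ord0) else 0].
exists b.
  apply/forallP => s; apply/implyP; rewrite ffunE; case: ifPn => [s0|]; last by rewrite eqxx.
  move=> cs; have /implyP/(_ cs)/andP[_ /eqP hs] := hc (s :\ ord0).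
  have cards : #|s|%:Z = q + 2 by rewrite (finset.cardsD1 ord0) s0 PoszD hs; lia.
  apply/andP; split; last by rewrite cards; apply/eqP; ring.
  have sn0 : s != finset.set0 by apply/finset.set0Pn; exists ord0.
  by rewrite finset.in_setU1 hK ?orbT.
apply/ffunP => t; rewrite ffunE; have [t0|t0] := boolP (ord0 \in t).
(* At a face containing [ord0], the cycle equation is read off at [t :\ ord0]. Its [ord0] term is
   [c t]; the other terms are those of [boundary b] at [t] with opposite sign, because [ord0]
   precedes every other [v] and adds one to the exponent. *)
- have t'0 : ord0 \notin t :\ ord0 by rewrite !inE eqxx.
  have := congr1 (fun f : {ffun {set 'I_n.+1} -> int} => f (t :\ ord0)) dc.
  rewrite !ffunE (bigD1 ord0) //= (_ : [set u in _ | _] = finset.set0); last first.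
    by apply/setP => u; rewrite !inE ltn0 andbF.
  rewrite finset.cards0 expr0 mul1r finset.setD1K // => /eqP; rewrite addr_eq0 => /eqP ->.
  rewrite -sumrN; apply: eq_big => [v|v vt].
    by rewrite !inE negb_and negbK; case: eqVneq => [->|] //=; rewrite ?t0 ?andbT.
  have v0 : v != ord0 by apply: contraNneq vt => ->.
  rewrite ffunE !inE t0 orbT -mulNr; congr (_ * c _).
    rewrite (finset.cardsD1 ord0) !inE t0 lt0n v0 exprS mulN1r; congr (- _ ^+ _).
    by apply: eq_card => u; rewrite !inE andbA.
  apply/setP => u; rewrite !inE; case: (eqVneq u v) => [->|//]; by rewrite v0.
(* At a face avoiding [ord0], only [v = ord0] contributes, since [b] vanishes on sets without
   [ord0]. *)
- rewrite (bigD1 ord0) //= big1 ?addr0 => [|v /andP[vt v0]].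
    rewrite (_ : [set u in _ | _] = finset.set0); last first.
      by apply/setP => u; rewrite !inE ltn0 andbF.
    by rewrite finset.cards0 expr0 mul1r ffunE !inE eqxx finset.setU1K.
  by rewrite ffunE !inE (negPf t0) eq_sym (negPf v0) mulr0.
Qed.

Lemma reduced_homology_eq0 (n : nat) (K : scomplex n) (q : int) :
  (forall c, is_cycle K q c -> exists2 b, is_chain K (q + 1) b & boundary b = c) ->
  forall x : reduced_homology K q, x = 0.
Proof.
move=> h x; rewrite -[x]reprK; apply/eqP; rewrite piE Quotient.equivE subr0.
by apply/asboolP; apply: h; apply: cycleP.
Qed.

(** * Independence of disjoint blocks, in counting form *)

Section Blocks.
Context (F : fieldType) (T : finType).

(** A subset [E] of [D] amounts to the independent pair [E :&: A], [E :\: A]; [f] sees only the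
    first component and [g] only the second. *)
Lemma sum_subsets_split (A D : {set T}) (f g : {set T} -> F) :
    A \subset D -> (forall E, f (E :&: A) = f E) ->
    (forall E, g (E :\: A) = g E) ->
  \sum_(E : {set T} | E \subset D) f E * g E =
  (\sum_(E : {set T} | E \subset A) f E) *
  (\sum_(E : {set T} | E \subset D :\: A) g E).
Proof.
move=> AD fA gA; rewrite big_distrlr /= pair_big /=.
rewrite [RHS](reindex_onto (fun E => (E :&: A, E :\: A)) (fun E => E.1 :|: E.2)) /=.
  apply: eq_big => [E|E _]; last by rewrite fA gA.
  rewrite finset.setID eqxx andbT finset.subsetIr finset.subsetD /=.
  rewrite [X in _ && X](_ : _ = true) ?andbT; last first.
    by rewrite disjoint_sym finset.disjoints_subset finset.setCD finset.subsetUr.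
  by rewrite finset.subDset (finset.setUidPr AD).
move=> [E1 E2] /= /andP[E1A]; rewrite finset.subsetD => /andP[E2D E2A].
have E21 : E2 :&: A = finset.set0 by apply/eqP; rewrite finset.setI_eq0.
congr pair; first by rewrite finset.setIUl E21 finset.setU0; apply/finset.setIidPl.
rewrite finset.setDUl (finset.setDidPl E2A).
by move: E1A; rewrite -finset.setD_eq0 => /eqP->; rewrite finset.set0U.
Qed.

(** Divided by [2 ^+ #|D|], the sum is the probability generating function at [x] of the number of
    blocks contained in a uniform random subset of [D]. Blocks are peeled off one at a time; by
    disjointness the remaining factors do not see [B i]. *)
Lemma sum_prod_blocks (I : eqType) (ws : seq I) (B : I -> {set T})
    (D : {set T}) (x : F) :
    (2%:R : F) != 0 -> uniq ws -> (forall i, i \in ws -> B i \subset D) ->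
    {in ws &, forall i j, i != j -> [disjoint B i & B j]} ->
  \sum_(E : {set T} | E \subset D)
     \prod_(i <- ws) (if B i \subset E then x else 1) =
  2 ^+ #|D| * \prod_(i <- ws) (1 - (1 - x) / 2 ^+ #|B i|).
Proof.
have sum1 (A : {set T}) : \sum_(E : {set T} | E \subset A) (1 : F) = 2 ^+ #|A|.
  rewrite sumr_const -natrX -finset.card_powerset; congr (_ *+ _).
  by apply: eq_card => E; rewrite !inE.
move=> F2; elim: ws D => [|i ws IH] D.
  move=> _ _ _; rewrite big_nil mulr1 -sum1.
  by apply: eq_bigr => E _; rewrite big_nil.
move=> /andP[iws uws] BD Bdisj.
have BiD : B i \subset D by apply: BD; rewrite inE eqxx.
rewrite (eq_bigr _ (fun E _ => big_cons _ _ _ _ _ _)) /=.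
rewrite (sum_subsets_split (B i)) //; first last.
- move=> E; apply: eq_big_seq => j jws.
  have ij : [disjoint B j & B i].
    apply: Bdisj; rewrite ?inE ?eqxx ?jws ?orbT //.
    by apply: contraNneq iws => <-.
  by rewrite finset.subsetD ij andbT.
- by move=> E; rewrite finset.subsetI fintype.subxx andbT.
rewrite IH //; first last.
- by move=> j k jws kws; apply: Bdisj; rewrite inE ?jws ?kws orbT.
- move=> j jws; rewrite finset.subsetD BD ?inE ?jws ?orbT //=.
  apply: Bdisj; rewrite ?inE ?eqxx ?jws ?orbT //.
  by apply: contraNneq iws => <-.
(* Among the subsets of [B i], only [B i] itself has weight [x]; all others have weight 1. *)
have -> : \sum_(E : {set T} | E \subset B i) (if B i \subset E then x else 1)
    = 2 ^+ #|B i| * (1 - (1 - x) / 2 ^+ #|B i|).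
  rewrite mulrBr mulr1 mulrCA divff ?expf_neq0 // mulr1 -sum1.
  rewrite (bigD1 (B i)) //= [in RHS](bigD1 (B i)) //= fintype.subxx.
  rewrite (eq_bigr (fun=> 1)) => [|E /andP[EB nE]]; first by ring.
  by move: nE; rewrite finset.eqEsubset EB /= => /negPf ->.
rewrite big_cons mulrACA -exprD; congr (2 ^+ _ * _).
by rewrite finset.cardsD (finset.setIidPr BiD) subnKC ?subset_leq_card.
Qed.
End Blocks.

(** * The uniform measure on graphs and the count of common neighbors *)

Lemma er_weight_half (R : realType) n (G : sgraph n) :
  er_weight (2^-1 : R) G = 2^-1 ^+ #|pairs n|.
Proof.
rewrite /er_weight -prodr_const; apply: eq_bigr => e _.
by case: ifP => // _; lra.
Qed.

Lemma sum_sgraph (R : realType) n (f : {set {set 'I_n}} -> R) :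
  \sum_(G : sgraph n) f (val G) = \sum_(E : {set {set 'I_n}} | E \subset pairs n) f E.
Proof.
rewrite [RHS](reindex_omap (val : sgraph n -> _) insub) => [|E EP]; last first.
  by rewrite insubT.
by apply: eq_bigl => G; rewrite valK eqxx (valP G).
Qed.

Lemma sum_er_weight_half (R : realType) n :
  \sum_(G : sgraph n) er_weight (2^-1 : R) G = 1.
Proof.
under eq_bigr do rewrite er_weight_half.
rewrite (sum_sgraph R n (fun=> _)) (eq_bigl (fun E => E \in finset.powerset (pairs n))).
  rewrite sumr_const finset.card_powerset -[LHS]mulr_natr natrX -exprMn.
  by rewrite mulVf ?expr1n // pnatr_eq0.
by move=> E; rewrite inE.
Qed.

Lemma er_prob_half_not (R : realType) n (A : sgraph n -> Prop) :
  er_prob (2^-1 : R) (fun G => ~ A G) = 1 - er_prob (2^-1 : R) A.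
Proof.
apply/eqP; rewrite eq_sym subr_eq addrC; apply/eqP.
rewrite -[LHS](sum_er_weight_half R n) (bigID (fun G => `[< A G >])) /=.
by congr (_ + _); apply: eq_bigl => G; rewrite asbool_neg.
Qed.

Lemma er_prob_half_union (R : realType) n (S : {set {set 'I_n}})
    (A : sgraph n -> Prop) (B : {set 'I_n} -> sgraph n -> Prop) :
    (forall G, A G -> exists2 s, s \in S & B s G) ->
  er_prob (2^-1 : R) A <= \sum_(s in S) er_prob (2^-1 : R) (B s).
Proof.
move=> AB; rewrite /er_prob big_mkcond /=.
under [leRHS]eq_bigr do rewrite big_mkcond /=.
rewrite exchange_big /=; apply: ler_sum => G _.
have w0 : 0 <= er_weight (2^-1 : R) G by rewrite er_weight_half exprn_ge0 // invr_ge0.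
case: asboolP => [/AB[s sS Bs]|_]; last first.
  by apply: sumr_ge0 => s _; case: ifP.
rewrite (bigD1 s) //= asboolT // lerDl; apply: sumr_ge0 => t _; by case: ifP.
Qed.

Lemma er_prob_few_common_neighbors (R : realType) (m n : nat) (s : {set 'I_n}) :
  er_prob (2^-1 : R) (fun G : sgraph n => (#|common_neighbors G s| < m)%N) <=
  2 ^+ m * (1 - 2^-1 ^+ #|s|.+1) ^+ (n - #|s|).
Proof.
(* B w is the set of edges which make w a common neighbor of s. *)
pose B (w : 'I_n) : {set {set 'I_n}} := [set [set v; w]%SET | v in s].
(* As [w] lies outside [s], the edge joining it to [v] in [s] determines both endpoints; this gives
   the size of each block and the disjointness of distinct blocks. *)
have pairE (v v' w w' : 'I_n) : v \in s -> v' \in s -> w \notin s ->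
    [set v; w]%SET = [set v'; w']%SET -> v = v' /\ w = w'.
  move=> vs vs' ws /setP e.
  have wv' : w != v' by apply: contraNneq ws => ->.
  have := e w; rewrite !inE eqxx orbT (negPf wv') /= => /esym/eqP ww'.
  have wv : v != w by apply: contraNneq ws => <-.
  by have := e v; rewrite -ww' !inE eqxx (negPf wv) !orbF /= => /esym/eqP ->.
have cardB w : w \notin s -> #|B w| = #|s|.
  by move=> ws; apply: card_in_imset => v v' vs vs' /(pairE _ _ _ _ vs vs' ws)[].
have Bpairs w : w \in enum (~: s)%SET -> B w \subset pairs n.
  rewrite mem_enum inE => ws; apply/fintype.subsetP => _ /imsetP[v vs ->].
  rewrite inE finset.cards2; suff -> : v != w by [].
  by apply: contraNneq ws => <-.
have Bdisj : {in enum (~: s)%SET &, forall w w', w != w' -> [disjoint B w & B w']}.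
  move=> w w'; rewrite !mem_enum !inE => ws ws'; apply: contraNT => /pred0Pn[e /andP[]].
  move=> /imsetP[v vs ->] /imsetP[v' vs']; by case/(pairE _ _ _ _ vs vs' ws) => _ /eqP.
(* [f E] is [2^-X], with [X] the number of vertices outside [s] joined by [E] to all of [s]. Fewer
   than [m] common neighbors forces [X < m], hence [1 <= 2 ^+ m * f E], which is the Markov step. *)
pose f (E : {set {set 'I_n}}) : R :=
  \prod_(w <- enum (~: s)%SET) (if B w \subset E then 2^-1 else 1).
have f0 E : 0 <= f E.
  by apply: prodr_ge0 => w _; case: ifP => _; rewrite ?invr_ge0 ?ler0n ?ler01.
have markov (G : sgraph n) : (#|common_neighbors G s| < m)%N -> 1 <= 2 ^+ m * f (val G).
  move=> Gm; rewrite /f big_enum_cond /= -big_mkcondr /= prodr_const.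
  rewrite exprVn ler_pdivlMr ?exprn_gt0 // mul1r ler_weXn2l ?ler1n //.
  apply/ltnW/(leq_ltn_trans _ Gm)/subset_leq_card/fintype.subsetP => w.
  rewrite unfold_in => /andP[_ /fintype.subsetP BG].
  rewrite inE; apply/forall_inP => v vs; apply: BG; exact: imset_f.
rewrite /er_prob big_mkcond /=.
apply: (@le_trans _ _ (\sum_(G : sgraph n) 2^-1 ^+ #|pairs n| * (2 ^+ m * f (val G)))).
  apply: ler_sum => G _; have w0 : 0 <= (2^-1 : R) ^+ #|pairs n| by rewrite exprn_ge0 // invr_ge0.
  rewrite er_weight_half; case: asboolP => [/markov h|_]; first by rewrite ler_peMr.
  by rewrite !mulr_ge0 // exprn_ge0.
rewrite -!mulr_sumr sum_sgraph (sum_prod_blocks _ _ _ _ B) ?pnatr_eq0 ?enum_uniq //.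
rewrite mulrCA mulrA mulrA -(mulrA (2 ^+ m)) -exprMn mulVf ?pnatr_eq0 // expr1n mulr1.
rewrite (eq_big_seq (fun=> 1 - 2^-1 ^+ #|s|.+1)) => [|w]; last first.
  rewrite mem_enum inE => /cardB ->; congr (1 - _).
  rewrite exprS exprVn; congr (_ / _); lra.
have -> : (n - #|s|)%N = #|(~: s)%SET| by rewrite [RHS]finset.cardsCs finset.setCK card_ord.
by rewrite big_enum /= prodr_const.
Qed.

(** * The asymptotic estimate *)

Lemma union_bound_tail (R : realType) (d : R) : 0 < d ->
  exists A : R, forall n k : nat, (0 < k)%N -> A <= ln n%:R ->
    k%:R * ln 2 <= (1 - d) * ln n%:R ->
    n%:R ^+ k * (1 - 2^-1 ^+ k.+1) ^+ (n - k) <= n%:R^-1 :> R.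
Proof.
move=> d0; have ln2 : 0 < ln (2 : R) by rewrite ln_gt0 // ltr1n.
pose C : R := (ln 2)^-1.
have C0 : 0 < C by rewrite invr_gt0.
(* With [L = ln n], the second entry gives [(C + 1) * L ^+ 2 <= (d * L) ^+ 3 / 24], and [1 <= L]
   lets the spare [L ^+ 2] absorb the [L] coming from [n%:R^-1]. *)
exists (Num.max 1 (24 * (C + 1) / d ^+ 3)) => n k k0.
rewrite ge_max => /andP[L1 LA] hk; set L := ln n%:R in L1 LA hk.
have L0 : 0 < L by lra.
have n0 : 0 < n%:R :> R by rewrite ltNge; apply/negP => /ln0; rewrite -/L; lra.
have nE : n%:R = expR L by rewrite lnK.
have kR : 1 <= k%:R :> R by rewrite ler1n.
have E2k : 2 ^+ k <= expR ((1 - d) * L).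
  by rewrite -[X in X ^+ k]lnK ?posrE // -expRM_natl ler_expR.
have k2n : (2 * k <= n)%N.
  have : 2 ^+ k <= n%:R :> R by apply: le_trans E2k _; rewrite nE ler_expR; nra.
  rewrite -natrX ler_nat; apply: leq_trans.
  by case: k k0 {hk kR E2k} => // k _; rewrite expnS leq_mul2l /= ltn_expl.
set x : R := 2^-1 ^+ k.+1.
have x0 : 0 <= x by rewrite exprn_ge0 // invr_ge0.
have x1 : x <= 1 by rewrite exprn_ile1 // ?invr_ge0 // invf_le1 // ler1n.
(* A cubic lower bound is enough to beat a quadratic in [L]. The 24 is 6 from the Taylor term of
   [expR (d * L)], times 2 from [n - k >= n / 2], times 2 from the extra factor in [x]. *)
have xN : (d * L) ^+ 3 / 24 <= (n - k)%:R * x.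
  have Nn : n%:R / 2 <= (n - k)%:R :> R.
    rewrite ler_pdivrMr // -natrM ler_nat; lia.
  apply: (@le_trans _ _ (n%:R / 2 * x)); last by rewrite ler_wpM2r.
  have e3 : (d * L) ^+ 3 / 6 <= expR (d * L).
    have dL : 0 <= d * L by rewrite mulr_ge0 // ltW.
    by have := expR_ge1Dxn 2 dL; rewrite (_ : 3`! = 6)%N //; lra.
  have : expR (d * L) <= n%:R * (2 ^+ k)^-1.
    rewrite ler_pdivlMr ?exprn_gt0 // nE (_ : L = d * L + (1 - d) * L); last by ring.
    by rewrite expRD (_ : d * _ = d * L) ?ler_wpM2l ?expR_ge0 //; ring.
  move=> h; have -> : n%:R / 2 * x = n%:R / 2 ^+ k / 4.
    by rewrite /x exprS exprVn; move: ((2 ^+ k)^-1) => y; field.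
  by move: e3 h; set a := n%:R / _; lra.
have xle : (1 - x) ^+ (n - k) <= expR (- ((n - k)%:R * x)).
  by rewrite -mulrN expRM_natl lerXn2r ?nnegrE ?expR_ge0 ?expR_ge1Dx //; lra.
apply: (@le_trans _ _ (n%:R ^+ k * expR (- ((n - k)%:R * x)))).
  by rewrite ler_wpM2l // exprn_ge0 // ltW.
rewrite nE -expRM_natl -expRN -expRD ler_expR.
have kC : k%:R <= C * L by rewrite -ler_pdivrMl ?invr_gt0 // invrK mulrC; nra.
have LA' : 24 * (C + 1) <= L * d ^+ 3 by rewrite -ler_pdivrMr ?exprn_gt0.
have : k%:R * L <= C * L ^+ 2 by rewrite expr2 mulrA ler_wpM2r // ltW.
have : (C + 1) * L ^+ 2 <= (d * L) ^+ 3 / 24.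
  rewrite ler_pdivlMr // (_ : (d * L) ^+ 3 = L * d ^+ 3 * L ^+ 2); last by ring.
  by rewrite mulrAC (mulrC _ 24) ler_wpM2r // exprn_ge0 // ltW.
by nra.
Qed.

(** * The union bound over vertex sets and the limit *)

Lemma leq_bin_expn (n k : nat) : ('C(n, k) <= n ^ k)%N.
Proof.
apply: (@leq_trans (n ^_ k)); first by rewrite -bin_ffact leq_pmulr ?fact_gt0.
rewrite ffact_prod -[X in (_ <= n ^ X)%N]card_ord -prod_nat_const.
by apply: leq_prod => i _; rewrite leq_subr.
Qed.

Theorem proposition1 (R : realType) (m : nat) (hm : (0 < m)%N)
    (eps : R) (heps : 0 < eps) (l : nat -> int)
    (hl : forall n : nat, (0 < n)%N ->
       (l n)%:~R <= (1 - eps / m%:R) * log2 (n%:R : R)) :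
  aas (2^-1 : R) (fun n (G : sgraph n) =>
    forall x : reduced_homology (multineighbor_complex m G) (l n - 2), x = 0).
Proof.
have d0 : 0 < eps / m%:R by rewrite divr_gt0 // ltr0n.
have [A hA] := union_bound_tail R _ d0.
have ln2 : 0 < ln (2 : R) by rewrite ln_gt0 // ltr1n.
pose bad n (G : sgraph n) := ~ forall x :
  reduced_homology (multineighbor_complex m G) (l n - 2), x = 0.
have badle n : (0 < n)%N -> A <= ln n%:R ->
    er_prob (2^-1 : R) (bad n) <= 2 ^+ m * n%:R^-1.
  move=> n0 An; pose S : {set {set 'I_n}} := [set s | (s != finset.set0) && (#|s|%:Z == l n)].
  apply: (le_trans (@er_prob_half_union R n S _
    (fun s G => (#|common_neighbors G s| < m)%N) _)).
    (* By contraposition: if no set in [S] has fewer than [m] common neighbors, all of them are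
       simplices and every cycle bounds. The case split on [n] supplies the cone vertex [ord0]. *)
    move=> G; apply: contra_notP => /forall2NP hS; apply: reduced_homology_eq0.
    case: n n0 An @S G hS => // n n0 An S G hS c.
    apply: skeleton_cycle_bounds => s s0; rewrite (_ : _ + _ = l n.+1); last by ring.
    move=> sl; case: (hS s); first by rewrite inE s0 sl eqxx.
    by rewrite inE s0 /= => /negP; rewrite -leqNgt.
  (* For [l n <= 0] the family [S] is empty and the union bound is 0. Otherwise any member of [S]
     exhibits [l n] as a positive natural number [k]. *)
  have [S0|[s0]] := finset.set_0Vmem S.
    by rewrite S0 finset.big_set0 mulr_ge0 ?exprn_ge0 ?invr_ge0.
  rewrite inE => /andP[]; rewrite -finset.card_gt0; move: #|s0| => k k0 /eqP kl.
  have kle : k%:R * ln 2 <= (1 - eps / m%:R) * ln (n%:R : R).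
    by have := hl n n0; rewrite -kl /log2 mulrA ler_pdivlMr.
  apply: (@le_trans _ _ (\sum_(s in S) 2 ^+ m * (1 - 2^-1 ^+ k.+1) ^+ (n - k))).
    apply: ler_sum => s; rewrite inE -kl => /andP[_ /eqP[<-]].
    exact: er_prob_few_common_neighbors.
  rewrite -mulr_sumr ler_wpM2l ?exprn_ge0 //.
  rewrite sumr_const -[leLHS]mulr_natl; apply: le_trans (hA n k k0 An kle); rewrite ler_wpM2r //.
    rewrite exprn_ge0 // subr_ge0 exprn_ile1 ?invr_ge0 // invf_le1 // ler1n //.
  rewrite -natrX ler_nat; apply: leq_trans (leq_bin_expn n k).
  rewrite -[X in 'C(X, _)]card_ord -card_draws; apply/subset_leq_card/fintype.subsetP => s.
  by rewrite !inE -kl => /andP[_ /eqP[->]].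
rewrite /aas.
have inv0 : ((1 - 2 ^+ m * n%:R^-1 : R) @[n --> \oo] --> (1 : R))%classic.
  rewrite -[X in (_ --> X)%classic]subr0 -[X in 1 - X](mulr0 (2 ^+ m)).
  apply: cvgB; first exact: cvg_cst.
  apply: cvgMl_tmp.
  apply/gtr0_cvgV0; last exact: cvgr_idn.
  by near=> n; rewrite ltr0n; near: n; exact: nbhs_infty_gt.
apply: (squeeze_cvgr _ inv0 (cvg_cst (1 : R))).
near=> n.
have n0 : (0 < n)%N by near: n; exact: nbhs_infty_gt.
have An : A <= ln n%:R.
  rewrite -[A]expRK ler_ln ?posrE ?expR_gt0 ?ltr0n //.
  by near: n; exact: nbhs_infty_ger.
have := badle n n0 An; rewrite er_prob_half_not => badn.
have : 0 <= er_prob (2^-1 : R) (bad n).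
  apply: sumr_ge0 => G _; by rewrite er_weight_half exprn_ge0 // invr_ge0.
rewrite er_prob_half_not; move: badn; set P := er_prob _ _ => h1 h2.
by apply/andP; split; lra.
Unshelve. all: by end_near.
Qed.
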